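(* Let $L$ be a locally compact Hausdorff topological space and let $Y$ be a uniformly monotone Banach lattice with a weak unit. Then the pair $(C_0(L),Y)$ has the Bishop-Phelps-Bollobás property for positive operators. Moreover, the function $\eta$ in the definition of this property depends only on the modulus of uniform monotonicity of $Y$; that is, for every function $\delta$ on $(0,1)$ with $0<\delta(\varepsilon)\le\varepsilon$ there is a function $\eta$ on $(0,1)$ with $0<\eta(\varepsilon)<\varepsilon$ such that $\eta$ satisfies the definition of the Bishop-Phelps-Bollobás property for positive operators for $(C_0(L),Y)$ for every locally compact Hausdorff space $L$ and every uniformly monotone Banach lattice $Y$ with a weak unit for which $\delta$ satisfies the definition of uniform monotonicity.
   Context: Banach lattices are real. $C_0(L)$ is the Banach lattice of real-valued continuous functions on $L$ vanishing at infinity, with the supremum norm and pointwise order. For Banach spaces $X,Y$: $S_X$ is the unit sphere of $X$, and $L(X,Y)$ is the space of bounded linear operators from $X$ to $Y$ with the operator norm. An operator $S$ between Banach lattices is positive ($S\ge 0$) if $S(x)\ge 0$ whenever $x\ge 0$; $X^+$ is the set of elements $x\ge 0$ of $X$. Bishop-Phelps-Bollobás property for positive operators: for Banach lattices $X,Y$, the pair $(X,Y)$ has this property if for every $0<\varepsilon<1$ there exists $0<\eta(\varepsilon)<\varepsilon$ such that for every positive $S\in S_{L(X,Y)}$, if $x_0\in S_X$ satisfies $\|S(x_0)\|>1-\eta(\varepsilon)$, then there exist $u_0\in S_X$ and a positive operator $T\in S_{L(X,Y)}$ with $\|T(u_0)\|=1$, $\|u_0-x_0\|<\varepsilon$ and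 $\|T-S\|<\varepsilon$. Uniform monotonicity: a Banach lattice $Y$ is uniformly monotone if for every $0<\varepsilon<1$ there is $0<\delta(\varepsilon)\le\varepsilon$ such that for all $x,y\in Y^+$ with $\|x\|=1$ and $\|x+y\|\le 1+\delta(\varepsilon)$ one has $\|y\|\le\varepsilon$. A function $\varepsilon\mapsto\delta(\varepsilon)$ as here is said to satisfy the definition of uniform monotonicity for $Y$ (a modulus of uniform monotonicity). A weak unit of a Banach lattice $Y$ is an element $e\in Y^+$ such that $e\wedge|y|=0$ implies $y=0$, for $y\in Y$. *)

(* Defs.v *)
From HB Require Import structures.
From mathcomp Require Import all_boot all_order all_algebra.
From mathcomp Require Import all_classical all_reals all_analysis.
From mathcomp Require Import ring.

Set Implicit Arguments.
Unset Strict Implicit.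
Unset Printing Implicit Defensive.

Import Order.TTheory GRing.Theory Num.Theory.
Import numFieldNormedType.Exports.

Local Open Scope classical_set_scope.
Local Open Scope ring_scope.

Reserved Notation "x <=^b y" (at level 70, y at next level).
Reserved Notation "x `|`^b y" (at level 52, left associativity).
Reserved Notation "x `&`^b y" (at level 48, left associativity).

                                                                            
                                                                       
                                                                            
HB.mixin Record isBanachLattice (R : realType) V & CompleteNormedModule R V := {
  ble : V -> V -> Prop;
  bjoin : V -> V -> V;
  bmeet : V -> V -> V;
  ble_refl : forall x, ble x x;
  ble_anti : forall x y, ble x y -> ble y x -> x = y;
  ble_trans : forall y x z, ble x y -> ble y z -> ble x z;
  ble_joinP : forall x y z, ble (bjoin x y) z <-> ble x z /\ ble y z;
  ble_meetP : forall x y z, ble z (bmeet x y) <-> ble z x /\ ble z y;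
  ble_add2r : forall z x y, ble x y -> ble (x + z) (y + z);
  ble_scale : forall (a : R) x, 0 <= a -> ble 0 x -> ble 0 (a *: x);
  ble_norm : forall x y, ble (bjoin x (- x)) (bjoin y (- y)) -> `|x| <= `|y|
}.

#[short(type="banachLatticeType")]
HB.structure Definition BanachLattice (R : realType) :=
  {V of isBanachLattice R V & CompleteNormedModule R V}.

Notation "x <=^b y" := (ble x y) : ring_scope.
Notation "x `|`^b y" := (bjoin x y) : ring_scope.
Notation "x `&`^b y" := (bmeet x y) : ring_scope.

                                              
Definition babs (R : realType) (V : banachLatticeType R) (x : V) : V :=
  x `|`^b (- x).

Section C0_space.
Context (R : realType) (L : topologicalType).

Definition vanishes_at_infinity (f : L -> R) :=
  forall e : R, 0 < e ->
    exists2 K : set L, compact K & forall x, ~ K x -> `|f x| < e.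

Definition C0_pred : {pred (L -> R)} :=
  mem [set f : L -> R | continuous f /\ vanishes_at_infinity f].

Lemma C0_predP (f : L -> R) :
  f \in C0_pred <-> continuous f /\ vanishes_at_infinity f.
Proof. by split=> [/set_mem|/mem_set]. Qed.

Lemma vanishes_dom (h f g : L -> R) : vanishes_at_infinity f ->
  vanishes_at_infinity g -> (forall x, `|h x| <= `|f x| + `|g x|) ->
  vanishes_at_infinity h.
Proof.
move=> f0 g0 hfg e e0; have e2 : 0 < e / 2 by rewrite divr_gt0.
have [K cK fK] := f0 _ e2; have [H cH gH] := g0 _ e2.
exists (K `|` H) => [|x /not_orP[Kx Hx]]; first exact: compactU.
by rewrite (le_lt_trans (hfg _))// [e]splitr ltrD ?fK ?gH.
Qed.

Lemma vanishesD (f g : L -> R) : vanishes_at_infinity f ->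
  vanishes_at_infinity g -> vanishes_at_infinity (f + g).
Proof. by move=> f0 g0; apply: (vanishes_dom f0 g0) => x; exact: ler_normD. Qed.

Lemma C0_submod_closed : submod_closed C0_pred.
Proof.
split=> [|a f g /C0_predP[cf f0] /C0_predP[cg g0]]; apply/C0_predP; split.
- by move=> x; exact: cvg_cst.
- move=> e e0; exists set0 => [|x _]; first exact: compact0.
  by rewrite normr0.
- move=> x; apply: (@continuousD R R L (a *: f) g x _ (cg x)).
  by apply: cvgM; [exact: cvg_cst|exact: cf].
- apply: vanishesD g0 => e e0.
  have a0 : 0 < `|a| + 1 by rewrite ltr_wpDl.
  have [K cK fK] := f0 _ (divr_gt0 e0 a0).
  exists K => // x /fK; rewrite normrM ltr_pdivlMr// mulrC.
  by apply: le_lt_trans; rewrite ler_wpM2r// lerDl.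
Qed.

HB.instance Definition _ := GRing.isSubmodClosed.Build R (L -> R) C0_pred
  C0_submod_closed.

Record C0 : Type := MkC0 { C0_fun :> L -> R ; C0_funP : C0_fun \in C0_pred }.

HB.instance Definition _ := [isSub for C0_fun].
HB.instance Definition _ := [Choice of C0 by <:].
HB.instance Definition _ := [SubChoice_isSubLmodule of C0 by <:].

Implicit Types f g h : C0.

Lemma C0P f g : (forall x, f x = g x) -> f = g.
Proof. by move=> fg; apply/val_inj/funext. Qed.

Lemma C0D f g x : (f + g) x = f x + g x. Proof. by []. Qed.
Lemma C0N f x : (- f) x = - f x. Proof. by []. Qed.
Lemma C0Z (a : R) f x : (a *: f) x = a * f x. Proof. by []. Qed.
Lemma C0_0 x : (0 : C0) x = 0. Proof. by []. Qed.

Lemma C0_continuous f : continuous f.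
Proof. by have /C0_predP[] := C0_funP f. Qed.

Lemma C0_vanishes f : vanishes_at_infinity f.
Proof. by have /C0_predP[] := C0_funP f. Qed.

Definition C0_norm f : R := sup (range (fun x => `|f x|)).

Lemma C0_bounded f : exists M, forall x, `|f x| <= M.
Proof.
have [K cK fK] := @C0_vanishes f _ (@ltr01 R).
have cf : {within K, continuous (f : L -> R)}.
  by apply: continuous_subspaceT; exact: C0_continuous.
have /compact_bounded[M [_ MK]] := continuous_compact cf cK.
exists (Num.max 1 (M + 1)) => x.
have [Kx|/fK/ltW fx] := pselect (K x).
  by rewrite le_max (MK (M + 1)) ?ltrDl ?orbT//; exists x.
by rewrite le_max fx.
Qed.

Lemma C0_norm_ub f x : `|f x| <= C0_norm f.
Proof.
apply: ub_le_sup; last by exists x.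
by have [M fM] := C0_bounded f; exists M => _ [y _ <-].
Qed.

Lemma C0_norm_le f (M : R) : 0 <= M -> (forall x, `|f x| <= M) -> C0_norm f <= M.
Proof.
move=> M0 fM; rewrite /C0_norm.
have [->|/set0P ne] := eqVneq (range (fun x => `|f x|)) set0.
  by rewrite sup0.
by apply: ge_sup => // _ [y _ <-].
Qed.

Lemma C0_norm_ge0 f : 0 <= C0_norm f.
Proof.
rewrite /C0_norm.
have [->|/set0P[_ [x _ _]]] := eqVneq (range (fun x => `|f x|)) set0.
  by rewrite sup0.
exact: le_trans (C0_norm_ub f x).
Qed.

Lemma C0_normD f g : C0_norm (f + g) <= C0_norm f + C0_norm g.
Proof.
apply: C0_norm_le => [|x]; first by rewrite addr_ge0 ?C0_norm_ge0.
by rewrite C0D (le_trans (ler_normD _ _))// lerD ?C0_norm_ub.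
Qed.

Lemma C0_normZ (a : R) f : C0_norm (a *: f) = `|a| * C0_norm f.
Proof.
apply/eqP; rewrite eq_le; apply/andP; split.
  apply: C0_norm_le => [|x]; first by rewrite mulr_ge0 ?C0_norm_ge0.
  by rewrite C0Z normrM ler_wpM2l// C0_norm_ub.
have [->|a0] := eqVneq a 0; first by rewrite normr0 mul0r C0_norm_ge0.
rewrite -ler_pdivlMl ?normr_gt0//; apply: C0_norm_le => [|x].
  by rewrite mulr_ge0 ?invr_ge0 ?C0_norm_ge0.
by rewrite ler_pdivlMl ?normr_gt0// -normrM -C0Z C0_norm_ub.
Qed.

Lemma C0_norm_eq0 f : C0_norm f = 0 -> f = 0.
Proof.
move=> f0; apply: C0P => x; apply/eqP.
by rewrite C0_0 -normr_le0 -f0 C0_norm_ub.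
Qed.

HB.instance Definition _ :=
  Lmodule_isNormed.Build R C0 C0_normD C0_normZ C0_norm_eq0.

Lemma C0_normE f : `|f| = sup (range (fun x => `|f x|)).
Proof. by []. Qed.

Lemma C0_complete (F : set_system C0) : ProperFilter F -> cauchy F -> cvg F.
Proof.
move=> FF /cauchy_ballP Fc.
have close (e : R) : 0 < e ->
    exists2 A : set C0, F A & forall f g, A f -> A g -> `|f - g| < e.
  move=> /Fc[[A B] /= [FA FB] AB].
  exists (A `&` B) => [|f g [Af Bf] [Ag Bg]]; first exact: filterI.
  by have := AB (f, g) (conj Af Bg); rewrite -ball_normE.
have lims x : cvg ((fun f : C0 => f x) @ F).
  apply: cauchy_cvg; apply/cauchy_ballP => e /close[A FA Ae].
  exists ((fun f : C0 => f x) @` A, (fun f : C0 => f x) @` A) => /=.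
    by split; apply: (@filterS _ F _ A) => // f Af; exists f.
  move=> [_ _] [/= [f Af <-] [g Ag <-]]; rewrite /ball/=.
  by apply: le_lt_trans (Ae _ _ Af Ag); exact: (C0_norm_ub (f - g) x).
pose l x : R := lim ((fun f : C0 => f x) @ F).
have near_l (e : R) : 0 < e -> F [set f : C0 | forall x, `|l x - f x| <= e].
  move=> /close[A FA Ae]; apply: (filterS _ FA) => f Af x.
  apply/ler_addgt0Pr => d d0.
  have /cvgrPdist_lt/(_ _ d0) ld := lims x.
  have [g [Ag gd]] := filter_ex (filterI FA ld).
  rewrite -(subrK (g x) (l x)) -addrA (le_trans (ler_normD _ _))//.
  rewrite [e + d]addrC; apply: lerD; first exact: ltW.
  exact: le_trans (C0_norm_ub (g - f) x) (ltW (Ae _ _ Ag Af)).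
have cl : continuous l.
  move=> x; apply/cvgrPdist_le => e e0.
  have e3 : 0 < e / 3 by rewrite divr_gt0.
  have [f fl] := filter_ex (near_l _ e3).
  have /cvgrPdist_le/(_ _ e3) := @C0_continuous f x.
  apply: filterS => y fxy.
  have -> : l x - l y = (l x - f x) + (f x - f y) - (l y - f y) by ring.
  have -> : e = e / 3 + e / 3 + e / 3 by field.
  rewrite (le_trans (ler_normB _ _))// lerD//.
  by rewrite (le_trans (ler_normD _ _))// lerD.
have l0 : vanishes_at_infinity l.
  move=> e e0; have e2 : 0 < e / 2 by rewrite divr_gt0.
  have [f fl] := filter_ex (near_l _ e2).
  have [K cK fK] := @C0_vanishes f _ e2.
  exists K => // x /fK fx.
  rewrite -(subrK (f x) (l x)) (le_lt_trans (ler_normD _ _))// [e]splitr.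
  by rewrite ler_ltD.
have lP : l \in C0_pred by apply/C0_predP.
apply/cvg_ex; exists (MkC0 lP); apply/cvgrPdist_le => e e0.
apply: filterS (near_l _ e0) => f fl.
by apply: C0_norm_le => //; exact: ltW.
Qed.

HB.instance Definition _ := Uniform_isComplete.Build C0 C0_complete.

Lemma C0_max_subproof f g : f \max g \in C0_pred.
Proof.
apply/C0_predP; split.
  by move=> x; apply: continuous_max; exact: C0_continuous.
apply: (vanishes_dom (@C0_vanishes f) (@C0_vanishes g)) => x /=.
by rewrite /Order.max; case: ifP => _; rewrite ?lerDl ?lerDr.
Qed.

Lemma C0_min_subproof f g : f \min g \in C0_pred.
Proof.
apply/C0_predP; split.
  by move=> x; apply: continuous_min; exact: C0_continuous.
apply: (vanishes_dom (@C0_vanishes f) (@C0_vanishes g)) => x /=.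
by rewrite /Order.min; case: ifP => _; rewrite ?lerDl ?lerDr.
Qed.

Definition C0_le f g : Prop := forall x, f x <= g x.
Definition C0_join f g : C0 := MkC0 (C0_max_subproof f g).
Definition C0_meet f g : C0 := MkC0 (C0_min_subproof f g).

Lemma C0_le_refl f : C0_le f f.
Proof. by move=> x. Qed.

Lemma C0_le_anti f g : C0_le f g -> C0_le g f -> f = g.
Proof. by move=> fg gf; apply: C0P => x; apply: le_anti; rewrite fg gf. Qed.

Lemma C0_le_trans g f h : C0_le f g -> C0_le g h -> C0_le f h.
Proof. by move=> fg gh x; exact: le_trans (fg x) (gh x). Qed.

Lemma C0_joinP f g h : C0_le (C0_join f g) h <-> C0_le f h /\ C0_le g h.
Proof.
split=> [fgh|[fh gh] x]; last by rewrite /= ge_max fh gh.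
by split=> x; have := fgh x; rewrite /= ge_max => /andP[].
Qed.

Lemma C0_meetP f g h : C0_le h (C0_meet f g) <-> C0_le h f /\ C0_le h g.
Proof.
split=> [hfg|[hf hg] x]; last by rewrite /= le_min hf hg.
by split=> x; have := hfg x; rewrite /= le_min => /andP[].
Qed.

Lemma C0_le_add2r h f g : C0_le f g -> C0_le (f + h) (g + h).
Proof. by move=> fg x; rewrite !C0D lerD2r. Qed.

Lemma C0_le_scale (a : R) f : 0 <= a -> C0_le 0 f -> C0_le 0 (a *: f).
Proof. by move=> a0 f0 x; rewrite C0Z mulr_ge0//; exact: f0. Qed.

Lemma C0_le_norm f g :
  C0_le (C0_join f (- f)) (C0_join g (- g)) -> `|f| <= `|g|.
Proof.
move=> fg; apply: C0_norm_le => [|x]; first exact: normr_ge0.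
apply: le_trans (C0_norm_ub g x).
have := fg x : Num.max (f x) (- f x) <= Num.max (g x) (- g x).
by rewrite !real_maxrN ?num_real.
Qed.

HB.instance Definition _ := isBanachLattice.Build R C0
  C0_le_refl C0_le_anti C0_le_trans C0_joinP C0_meetP
  C0_le_add2r C0_le_scale C0_le_norm.

End C0_space.

Arguments C0 : clear implicits.

Section operators.
Context (R : realType) (X Y : banachLatticeType R).

                                                                              
Definition opnorm (S : X -> Y) : R := sup [set `|S x| | x in [set x | `|x| <= 1]].

                                                               
Definition unit_operator (S : {linear X -> Y}) :=
  bounded_fun_norm S /\ opnorm S = 1.

Definition positive_operator (S : X -> Y) := forall x, 0 <=^b x -> 0 <=^b S x.

                                                                         
Definition bpb_positive_at (eps eta : R) :=
  forall S : {linear X -> Y}, unit_operator S -> positive_operator S ->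
  forall x0 : X, `|x0| = 1 -> `|S x0| > 1 - eta ->
  exists (u0 : X) (T : {linear X -> Y}),
    [/\ `|u0| = 1, unit_operator T & positive_operator T] /\
    [/\ `|T u0| = 1, `|u0 - x0| < eps & opnorm (T \- S) < eps].

Definition bpb_positive :=
  forall eps : R, 0 < eps < 1 ->
    exists2 eta : R, 0 < eta < eps & bpb_positive_at eps eta.

End operators.

Arguments bpb_positive_at {R} X Y.
Arguments bpb_positive {R} X Y.

Section monotonicity.
Context (R : realType) (Y : banachLatticeType R).

Definition uniformly_monotone_at (eps delta : R) :=
  forall x y : Y, 0 <=^b x -> 0 <=^b y ->
    `|x| = 1 -> `|x + y| <= 1 + delta -> `|y| <= eps.

Definition uniformly_monotone :=
  forall eps : R, 0 < eps < 1 ->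
    exists2 delta : R, 0 < delta <= eps & uniformly_monotone_at eps delta.

Definition monotonicity_modulus (delta : R -> R) :=
  forall eps : R, 0 < eps < 1 ->
    0 < delta eps <= eps /\ uniformly_monotone_at eps (delta eps).

Definition weak_unit (e : Y) :=
  0 <=^b e /\ forall y : Y, e `&`^b babs y = 0 -> y = 0.

End monotonicity.

Arguments uniformly_monotone {R} Y.
Arguments monotonicity_modulus {R} Y.

(* Main.v *)
From HB Require Import structures.
Require Import Defs.
From mathcomp Require Import all_boot all_order all_algebra.
From mathcomp Require Import all_classical all_reals all_analysis.
From mathcomp Require Import ring lra.

Import Order.TTheory GRing.Theory Num.Theory.
Import numFieldNormedType.Exports.

Local Open Scope classical_set_scope.
Local Open Scope ring_scope.

(** Let [S] be positive of norm one on [C0 R L], almost attaining its norm at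
    [x0], and write [x0+], [x0-] for the positive and negative parts.  The
    operator [T] is assembled from the pieces of [S] that do the norming.

    Two facts come from uniform monotonicity.  First, [|S x0|] is nearly of full
    norm and below [S |x0|], whose norm is at most one, so the excess
    [S |x0| - |S x0|] is small.  If [P] and [Q] are the complementary projections
    onto the bands where [S x0] is positive and negative, the excess equals
    [2 (P S x0- + Q S x0+)]: the part of [S x0+] in the negative band and that of
    [S x0-] in the positive band are negligible ([sign_splitting]).  Second, where
    [|x0|] stays below [1 - a / 2] one can add to [|x0|] any function [a / 2 * g] with
    [0 <= g <= 1] that vanishes elsewhere and remain in the unit ball, so [S g]
    is small for such [g] ([ramp_room]).

    Choose continuous cutoffs [phi] and [psi], functions of [x0] that live where
    [x0] is near [1] and near [-1] and equal [1] still closer to these values,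
    and put [T' f = P (S (f phi)) + Q (S (f psi))].  By the two facts [T'] is
    close to [S].  Let [u0] be [x0 / (1 - a)] truncated to [[-1, 1]]; it is uniformly
    close to [x0], and it is [1] on the support of [phi] and [-1] on that of
    [psi], so that [T' u0 = P (S phi) - Q (S psi)].  The two terms are disjoint,
    hence this has the norm of [P (S phi) + Q (S psi)], which dominates [|T' f|]
    for every [f] in the unit ball.  So [T'] attains its norm at [u0], and [T]
    is [T'] divided by its norm ([normalize_attaining]).

    The projections exist because in a uniformly monotone lattice
    order-bounded increasing sequences converge ([monotone_lub]): the component
    of [x >= 0] in the band of [e] is the supremum of the truncations of [x] by
    the multiples of [e].  All constants depend on [eps] and the modulus only. *)

(** * Order and norm in a Banach lattice *)

Section BanachLatticeTheory.
Local Set Implicit Arguments.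
Local Unset Strict Implicit.
Context {R : realType} {V : banachLatticeType R}.
Implicit Types x y z a b c d e p q w : V.

Lemma ble_subr x y : x <=^b y <-> 0 <=^b y - x.
Proof.
split=> h; first by have := ble_add2r (- x) _ _ h; rewrite subrr.
by have := ble_add2r x _ _ h; rewrite add0r subrK.
Qed.

Lemma ble_add a b c d : a <=^b b -> c <=^b d -> a + c <=^b b + d.
Proof.
move=> ab cd; apply: (ble_trans (b + c)); first exact: ble_add2r.
by rewrite ![b + _]addrC; exact: ble_add2r.
Qed.

Lemma ble_addr_ge0 a b : 0 <=^b a -> 0 <=^b b -> 0 <=^b a + b.
Proof. by move=> a0 b0; rewrite -[0](addr0 0); exact: ble_add. Qed.

Lemma ble_addl a b : 0 <=^b b -> a <=^b a + b.
Proof.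
by move=> b0; rewrite -{1}[a]addr0; apply: ble_add => //; exact: ble_refl.
Qed.

Lemma ble_subl_addr a b c : a - b <=^b c <-> a <=^b c + b.
Proof. by rewrite ble_subr [a <=^b _]ble_subr opprB addrA. Qed.

Lemma ble_subr_addr a b c : a <=^b c - b <-> a + b <=^b c.
Proof. by rewrite -ble_subl_addr opprK. Qed.

Lemma ble_subr_self a b : a <=^b a - b -> b <=^b 0.
Proof. by rewrite ble_subr_addr addrC -ble_subr_addr subrr. Qed.

Lemma ble_opp a b : a <=^b b <-> - b <=^b - a.
Proof. by rewrite ble_subr [- b <=^b _]ble_subr opprK addrC. Qed.

Lemma ble_scale_mono (r : R) a b : 0 <= r -> a <=^b b -> r *: a <=^b r *: b.
Proof.
move=> r0 /ble_subr ab; apply/ble_subr; rewrite -scalerBr; exact: ble_scale.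
Qed.

Lemma ble_meetl a b : a `&`^b b <=^b a.
Proof. by have [] := (ble_meetP a b (a `&`^b b)).1 (ble_refl _). Qed.

Lemma ble_meetr a b : a `&`^b b <=^b b.
Proof. by have [] := (ble_meetP a b (a `&`^b b)).1 (ble_refl _). Qed.

Lemma ble_joinl a b : a <=^b a `|`^b b.
Proof. by have [] := (ble_joinP a b (a `|`^b b)).1 (ble_refl _). Qed.

Lemma ble_joinr a b : b <=^b a `|`^b b.
Proof. by have [] := (ble_joinP a b (a `|`^b b)).1 (ble_refl _). Qed.

Lemma ble_norm_dom x y : x <=^b y -> - x <=^b y -> `|x| <= `|y|.
Proof.
move=> xy nxy; apply: ble_norm; apply: (ble_trans y); last exact: ble_joinl.
exact/ble_joinP.
Qed.

Lemma ble_norm_pos x y : 0 <=^b x -> x <=^b y -> `|x| <= `|y|.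
Proof.
move=> x0 xy; apply: ble_norm_dom => //; apply: (ble_trans x) => //.
apply: (ble_trans 0) => //.
by apply/ble_opp; rewrite opprK oppr0.
Qed.

Lemma ble_half x y : x <=^b y + y -> 2^-1 *: x <=^b y.
Proof.
have h2 : 0 <= 2^-1 :> R by rewrite invr_ge0.
move/(ble_scale_mono h2); rewrite -mulr2n -(scaler_nat 2 y) scalerA mulVf//.
by rewrite scale1r.
Qed.

(** In a vector lattice twice [|x|] dominates [x + (- x)]. *)
Lemma babs_ge0 x : 0 <=^b babs x.
Proof.
rewrite -[0](scaler0 _ (2^-1 : R)); apply: ble_half; rewrite -(subrr x).
by apply: ble_add; [exact: ble_joinl|exact: ble_joinr].
Qed.

Lemma norm_babs x : `|babs x| = `|x|.
Proof.
apply/eqP; rewrite eq_le; apply/andP; split; last first.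
  by apply: ble_norm_dom; [exact: ble_joinl|exact: ble_joinr].
apply: ble_norm; apply/ble_joinP; split; first exact: ble_refl.
apply: (ble_trans 0); last exact: babs_ge0.
by apply/ble_opp; rewrite opprK oppr0; exact: babs_ge0.
Qed.

(** The positive cone is norm closed, because the negative part of [x] is
    dominated by [|x - a|] for every [a >= 0]. *)
Lemma ble_closed x : (forall r : R, 0 < r -> exists2 a, 0 <=^b a & `|x - a| <= r) ->
  0 <=^b x.
Proof.
move=> xa; suff n0 : `|0 `|`^b (- x)| = 0.
  apply/ble_opp; rewrite oppr0 -(normr0_eq0 n0); exact: ble_joinr.
apply/eqP; rewrite eq_le normr_ge0 andbT; apply/ler_addgt0Pr => r r0; rewrite add0r.
have [a a0 ax] := xa _ r0; apply: le_trans ax; rewrite -[`|x - a|]norm_babs.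
apply: ble_norm_pos; first exact: ble_joinl.
apply/ble_joinP; split; first exact: babs_ge0.
apply: (ble_trans (- (x - a))); last exact: ble_joinr.
by rewrite opprB ble_subr opprK subrK.
Qed.

(** The element [a + b - d] lies below both [a] and [b]. *)
Lemma disjoint_add_le a b d : a `&`^b b <=^b 0 -> a <=^b d -> b <=^b d ->
  a + b <=^b d.
Proof.
move=> ab ad bd; suff : a + b - d <=^b 0 by rewrite ble_subl_addr add0r.
apply: ble_trans ab; apply/ble_meetP; split.
  by apply/ble_subl_addr; rewrite [a + b]addrC [a + d]addrC; exact: ble_add2r.
by apply/ble_subl_addr; rewrite [b + d]addrC; exact: ble_add2r.
Qed.

(** For disjoint [a] and [b] one has [a + b = |a - b|]: half of
    [a + b - |a - b|] lies below [a] and below [b]. *)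
Lemma disjoint_norm_le a b : 0 <=^b a -> 0 <=^b b -> a `&`^b b <=^b 0 ->
  `|a + b| <= `|a - b|.
Proof.
move=> a0 b0 ab; rewrite -[X in _ <= X]norm_babs.
apply: ble_norm_pos; first exact: ble_addr_ge0.
set c := babs (a - b).
have half_le u v : v - u <=^b c -> 2^-1 *: (u + v - c) <=^b u.
  move=> uvc; apply: ble_half; rewrite ble_subl_addr -addrA.
  apply: ble_add; first exact: ble_refl.
  by rewrite addrC -ble_subl_addr.
have s0 : 2^-1 *: (a + b - c) <=^b 0.
  apply: ble_trans ab; apply/ble_meetP; split.
    by apply: half_le; rewrite -opprB; exact: ble_joinr.
  by rewrite [a + b]addrC; apply: half_le; exact: ble_joinl.
have := ble_scale_mono (ler0n R 2) s0.
by rewrite scalerA divff ?pnatr_eq0// scale1r scaler0 ble_subl_addr add0r.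
Qed.

(** * Uniform monotonicity *)

Lemma uniformly_monotone_scale (eps delta : R) a b :
  uniformly_monotone_at V eps delta -> 0 <=^b a -> 0 <=^b b -> a != 0 ->
  `|a + b| <= (1 + delta) * `|a| -> `|b| <= eps * `|a|.
Proof.
move=> um a0 b0 an0 abd; have na : 0 < `|a| by rewrite normr_gt0.
have ia : 0 <= `|a|^-1 by rewrite invr_ge0 ltW.
have nrm x : `| `|a|^-1 *: x| = `|x| / `|a| by rewrite normrZ ger0_norm// mulrC.
rewrite -ler_pdivrMr// -nrm; apply: (um (`|a|^-1 *: a)).
- exact: ble_scale.
- exact: ble_scale.
- by rewrite nrm divff ?gt_eqF.
- by rewrite -scalerDr nrm ler_pdivrMr.
Qed.

(** The form in which the modulus is used: an element of almost full norm leaves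
    no room in the unit ball for a large positive increment. *)
Lemma uniformly_monotone_small (eps delta : R) a b :
  uniformly_monotone_at V eps delta -> 0 <= eps -> 0 < delta <= 1 ->
  0 <=^b a -> 0 <=^b b -> 1 - delta / 2 < `|a| -> `|a + b| <= 1 -> `|b| <= eps.
Proof.
move=> um e0 /andP[d0 d1] a0 b0 ad ab1.
have an0 : a != 0 by rewrite -normr_gt0; lra.
have a1 : `|a| <= 1.
  by apply: le_trans ab1; apply: ble_norm_pos => //; exact: ble_addl.
apply: (@le_trans _ _ (eps * `|a|)); last by rewrite ler_piMr.
apply: (uniformly_monotone_scale um a0 b0 an0).
(* [1 <= (1 + delta) * (1 - delta / 2)] since [delta <= 1] *)
by nra.
Qed.

(** In a uniformly monotone lattice an order-bounded increasing sequence is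
    norm Cauchy: once [`|u N|] is within a factor [1 + delta] of the supremum of
    the norms, every later increment is small. *)
Lemma monotone_lub (u : nat -> V) y : uniformly_monotone V ->
  (forall n, 0 <=^b u n) -> (forall m n, (m <= n)%N -> u m <=^b u n) ->
  (forall n, u n <=^b y) ->
  exists p, (forall n, u n <=^b p) /\ forall q, (forall n, u n <=^b q) -> p <=^b q.
Proof.
move=> um u0 u_incr uy.
have nu n : `|u n| <= `|y| by exact: ble_norm_pos.
pose M := sup (range (fun n => `|u n|)).
have hs : has_sup (range (fun n => `|u n|)).
  by split; [exists `|u 0|, 0%N|exists `|y| => _ [n _ <-]].
have uM n : `|u n| <= M by apply: ub_le_sup; [exact: hs.2|exists n].
have [M0|M0] := leP M 0.
  have uz n : u n = 0 by apply/eqP; rewrite -normr_le0 (le_trans (uM n)).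
  by exists 0; split=> [n|q /(_ 0%N)]; rewrite uz//; exact: ble_refl.
have increment (e : R) : 0 < e ->
    exists N, forall n, (N <= n)%N -> `|u n - u N| <= e.
  move=> e0; pose e' := Num.min 2^-1 (e / M).
  have e'0 : 0 < e' < 1.
    rewrite lt_min invr_gt0 ltr0n divr_gt0//= gt_min.
    by rewrite invf_lt1 ?ltr0n// ltr1n.
  have [d /andP[d0 _] umd] := um _ e'0.
  have d1 : 0 < 1 + d by rewrite addr_gt0.
  have : 0 < M - M / (1 + d).
    by rewrite subr_gt0 ltr_pdivrMr// ltr_pMr// ltrDl.
  move=> /(@sup_adherent R)/(_ hs)[_ [N _ <-]]; rewrite subKr => uN.
  have MuN : M <= (1 + d) * `|u N| by rewrite mulrC -ler_pdivrMr// ltW.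
  have uN0 : u N != 0 by rewrite -normr_gt0 (le_lt_trans _ uN)// divr_ge0 ?ltW.
  exists N => n Nn; apply: (@le_trans _ _ (e' * `|u N|)).
    apply: (uniformly_monotone_scale umd) => //.
      by rewrite -ble_subr; exact: u_incr.
    by rewrite addrC subrK (le_trans (uM n)).
  apply: (@le_trans _ _ (e / M * M)); last by rewrite divfK ?gt_eqF.
  apply: ler_pM => //; first by case/andP: e'0 => /ltW.
  by rewrite ge_min lexx orbT.
have : cvg (u @ \oo).
  apply: cauchy_cvg; apply: cauchy_exP => e e0.
  have [N Nu] := increment _ (divr_gt0 e0 (ltr0n R 2)).
  exists (u N); rewrite -ball_normE; apply: (@filterS _ \oo _ _ _ _ (nbhs_infty_ge N)).
  move=> n /= Nn; rewrite distrC (le_lt_trans (Nu _ Nn))//.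
  by rewrite ltr_pdivrMr// ltr_pMr// ltr1n.
move=> /cvg_ex[p up].
have near_p (e : R) : 0 < e -> \forall n \near \oo, `|p - u n| <= e.
  by move=> e0; move/cvgrPdist_le: up; exact.
exists p; split=> [n|q uq]; apply/ble_subr; apply: ble_closed => e e0.
  have [m [pm nm]] := filter_ex (filterI (near_p _ e0) (nbhs_infty_ge n)).
  exists (u m - u n); first by rewrite -ble_subr; exact: u_incr.
  by rewrite opprB addrA subrK.
have [m pm] := filter_ex (near_p _ e0).
exists (q - u m); first by rewrite -ble_subr; exact: uq.
by rewrite opprB addrC addrA subrK distrC.
Qed.

(** * Band projections *)

Definition bpos x := 0 `|`^b x.

Lemma bpos_ge0 x : 0 <=^b bpos x. Proof. exact: ble_joinl. Qed.

Lemma bpos_sub x : bpos x - bpos (- x) = x.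
Proof.
apply/eqP; rewrite subr_eq; apply/eqP; apply: ble_anti.
  apply/ble_joinP; split; last by apply: ble_addl; exact: bpos_ge0.
  by rewrite addrC -ble_subl_addr sub0r; exact: ble_joinr.
rewrite addrC -ble_subr_addr; apply/ble_joinP; split.
  by rewrite -ble_subr; exact: ble_joinr.
by rewrite ble_subr_addr addrC subrr; exact: bpos_ge0.
Qed.

Lemma bpos_disjoint x : bpos x `&`^b bpos (- x) <=^b 0.
Proof.
set t := _ `&`^b _; have h : bpos x <=^b bpos x - t.
  apply/ble_joinP; split; first by rewrite -ble_subr; exact: ble_meetl.
  rewrite -{1}[x]bpos_sub; apply: ble_add; first exact: ble_refl.
  by apply/(ble_opp _ _).1; exact: ble_meetr.
exact: ble_subr_self h.
Qed.

(** Two decompositions of [x] into differences of positive elements differ by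
    an identity inside the cone, where [f] is additive. *)
Lemma cone_linear_extension (f : V -> V) :
  (forall x y, 0 <=^b x -> 0 <=^b y -> f (x + y) = f x + f y) ->
  (forall (r : R) x, 0 <= r -> 0 <=^b x -> f (r *: x) = r *: f x) ->
  exists P : {linear V -> V}, forall x, 0 <=^b x -> P x = f x.
Proof.
move=> fD fZ; pose g x := f (bpos x) - f (bpos (- x)).
have gE a b : 0 <=^b a -> 0 <=^b b -> g (a - b) = f a - f b.
  move=> a0 b0; set x := a - b; apply/eqP.
  rewrite subr_eq addrAC eq_sym subr_eq -!fD//; try exact: bpos_ge0.
  apply/eqP; congr f; apply/eqP.
  by rewrite -subr_eq addrAC eq_sym -subr_eq bpos_sub.
have gD x y : g (x + y) = g x + g y.
  rewrite -{1}[x]bpos_sub -{1}[y]bpos_sub addrACA -opprD gE;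
    try by apply: ble_addr_ge0; exact: bpos_ge0.
  by rewrite !fD ?opprD 1?addrACA//; exact: bpos_ge0.
have gN x : g (- x) = - g x by rewrite /g opprK opprB.
have gZ (r : R) x : 0 <= r -> g (r *: x) = r *: g x.
  move=> r0; rewrite -{1}[x]bpos_sub scalerBr gE;
    try by apply: ble_scale => //; exact: bpos_ge0.
  by rewrite !fZ -?scalerBr//; exact: bpos_ge0.
have g_linear : linear g.
  move=> r x y; rewrite gD; congr (_ + _).
  have [r0|/ltW r0] := leP 0 r; first exact: gZ.
  by rewrite -[r]opprK scaleNr gN gZ ?oppr_ge0// [in RHS]scaleNr.
have f0 : f 0 = 0.
  rewrite -[X in f X](scale0r (0 : V)) fZ ?scale0r//; exact: ble_refl.
pose P : {linear V -> V} := HB.pack g (GRing.isLinear.Build _ _ _ _ g g_linear).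
exists P => x x0; rewrite -[x in LHS]subr0 /= gE// ?f0 ?subr0//; exact: ble_refl.
Qed.

(** For [x, e >= 0] this makes [p] the component of [x] in the band generated by
    [e]; a characterization as a supremum lets order arguments replace limits. *)
Definition band_component e x p :=
  (forall r : R, 0 <= r -> x `&`^b (r *: e) <=^b p) /\
  (forall q, (forall r : R, 0 <= r -> x `&`^b (r *: e) <=^b q) -> p <=^b q).

Lemma band_component_exists e x : uniformly_monotone V -> 0 <=^b e ->
  0 <=^b x -> exists p, band_component e x p.
Proof.
move=> um e0 x0.
have [|m n mn|n|p [up pu]] := @monotone_lub (fun n => x `&`^b (n%:R *: e)) x um.
- by move=> n; apply/ble_meetP; split=> //; exact: ble_scale.
- apply/ble_meetP; split; first exact: ble_meetl.
  apply: (ble_trans (m%:R *: e)); first exact: ble_meetr.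
  by rewrite ble_subr -scalerBl; apply: ble_scale => //; rewrite subr_ge0 ler_nat.
- exact: ble_meetl.
exists p; split=> [r r0|q qu]; last by apply: pu => n; exact: qu.
apply: ble_trans (up (Num.bound r)); apply/ble_meetP; split; first exact: ble_meetl.
apply: (ble_trans (r *: e)); first exact: ble_meetr.
rewrite ble_subr -scalerBl; apply: ble_scale => //.
by rewrite subr_ge0 ltW// archi_boundP.
Qed.

(** Truncation by [r e] is subadditive, and the sum of two truncations is below
    the truncation of the sum by a larger multiple. *)
Lemma band_componentD e x y p q : 0 <=^b e -> 0 <=^b x -> 0 <=^b y ->
  band_component e x p -> band_component e y q -> band_component e (x + y) (p + q).
Proof.
move=> e0 x0 y0 [xp px] [yq qy]; split=> [r r0|s xys].
  set m := (x + y) `&`^b _.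
  have re0 : 0 <=^b r *: e by exact: ble_scale.
  have mx : m - x `&`^b (r *: e) <=^b y `&`^b (r *: e).
    apply/ble_meetP; split; rewrite ble_subl_addr addrC -ble_subl_addr.
      apply/ble_meetP; split; first by rewrite ble_subl_addr; exact: ble_meetl.
      rewrite ble_subl_addr; apply: (ble_trans (r *: e)); first exact: ble_meetr.
      exact: ble_addl.
    apply: (ble_trans 0); last by apply/ble_meetP.
    by rewrite ble_subl_addr add0r; exact: ble_meetr.
  apply: (ble_trans (x `&`^b (r *: e) + y `&`^b (r *: e))).
    by rewrite addrC -ble_subl_addr.
  by apply: ble_add; [exact: xp|exact: yq].
rewrite addrC -(opprK p) ble_subl_addr; apply: qy => t t0.
rewrite -ble_subl_addr opprK addrC -[y `&`^b _]opprK ble_subl_addr.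
apply: px => r r0; rewrite -ble_subl_addr opprK.
apply: ble_trans (xys (r + t) (addr_ge0 r0 t0)).
by apply/ble_meetP; rewrite scalerDl; split; apply: ble_add;
  (exact: ble_meetl || exact: ble_meetr).
Qed.

Lemma band_component_uniq e x p q :
  band_component e x p -> band_component e x q -> p = q.
Proof. by move=> [xp px] [xq qx]; apply: ble_anti; [exact: px|exact: qx]. Qed.

Lemma band_componentZ e x p (t : R) : 0 < t ->
  band_component e x p -> band_component e (t *: x) (t *: p).
Proof.
move=> t0 [xp px]; have it : 0 <= t^-1 by rewrite invr_ge0 ltW.
have tK z : t *: (t^-1 *: z) = z by rewrite scalerA divff ?gt_eqF// scale1r.
have tV z : t^-1 *: (t *: z) = z by rewrite scalerA mulVf ?gt_eqF// scale1r.
split=> [r r0|q xq].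
  rewrite -[_ `&`^b _]tK; apply: ble_scale_mono; first exact: ltW.
  apply: ble_trans (xp (t^-1 * r) _); last exact: mulr_ge0.
  rewrite -{2}[x]tV -scalerA; apply/ble_meetP.
  by split; apply: ble_scale_mono => //; [exact: ble_meetl|exact: ble_meetr].
rewrite -[q]tK; apply: ble_scale_mono; first exact: ltW.
apply: px => r r0; rewrite -[_ `&`^b _]tV; apply: ble_scale_mono => //.
apply: ble_trans (xq (t * r) _); last by apply: mulr_ge0 => //; exact: ltW.
rewrite -scalerA; apply/ble_meetP.
by split; (apply: ble_scale_mono; first exact: ltW);
  [exact: ble_meetl|exact: ble_meetr].
Qed.

(** The element [y - q] is disjoint from every multiple of [e], hence from
    everything below the supremum [p] of elements dominated by such multiples. *)
Lemma band_component_disjoint e x y p q : 0 <=^b e ->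
  band_component e x p -> band_component e y q -> p `&`^b (y - q) <=^b 0.
Proof.
move=> e0 [xp px] [yq qy].
have ye r : 0 <= r -> (y - q) `&`^b (r *: e) <=^b 0.
  move=> r0; set v := _ `&`^b _.
  apply: (@ble_subr_self q).
  apply: qy => s s0; rewrite -ble_subl_addr opprK addrC.
  apply: ble_trans (yq (r + s) (addr_ge0 r0 s0)); apply/ble_meetP; split.
    apply: (ble_trans (y - q + q)); last by rewrite subrK; exact: ble_refl.
    by apply: ble_add; [exact: ble_meetl|exact: yq].
  by rewrite scalerDl; apply: ble_add; exact: ble_meetr.
set w := _ `&`^b _.
apply: (@ble_subr_self p).
apply: px => r r0; rewrite -ble_subl_addr opprK.
apply: disjoint_add_le; [|exact: xp|exact: ble_meetl].
apply: ble_trans (ye _ r0); apply/ble_meetP; split.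
  by apply: (ble_trans w); exact: ble_meetr.
by apply: (ble_trans (x `&`^b (r *: e))); [exact: ble_meetl|exact: ble_meetr].
Qed.

Lemma disjoint_scaler a b (r : R) : 0 <=^b a -> 0 <=^b b -> 0 <= r ->
  a `&`^b b <=^b 0 -> a `&`^b (r *: b) <=^b 0.
Proof.
move=> a0 b0 r0 ab; set s := _ `&`^b _; have r1 : 0 < 1 + r by rewrite ltr_wpDr.
have rV x : (1 + r)^-1 *: ((1 + r) *: x) = x.
  by rewrite scalerA mulVf ?gt_eqF// scale1r.
have s0 : (1 + r)^-1 *: s <=^b 0.
  have ir : 0 <= (1 + r)^-1 by rewrite invr_ge0 ltW.
  apply: ble_trans ab; apply/ble_meetP.
  split; [rewrite -[X in _ <=^b X](rV a)|rewrite -[X in _ <=^b X](rV b)];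
    apply: ble_scale_mono => //; rewrite scalerDl scale1r.
    apply: (ble_trans a); first exact: ble_meetl.
    by apply: ble_addl; exact: ble_scale.
  apply: (ble_trans (r *: b)); first exact: ble_meetr.
  by rewrite addrC; exact: ble_addl.
have := ble_scale_mono (ltW r1) s0.
by rewrite scalerA divff ?gt_eqF// scale1r scaler0.
Qed.

End BanachLatticeTheory.

(** * Splitting along the sign of an element *)

Section PositiveOperators.
Local Set Implicit Arguments.
Local Unset Strict Implicit.
Context {R : realType} {X Y : banachLatticeType R}.

Lemma positive_operator_mono (S : {linear X -> Y}) : positive_operator S ->
  forall x y, x <=^b y -> S x <=^b S y.
Proof. by move=> S0 x y /ble_subr/S0; rewrite linearB -ble_subr. Qed.

End PositiveOperators.

Section SignSplitting.
Local Set Implicit Arguments.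
Local Unset Strict Implicit.
Context {R : realType} {V : banachLatticeType R}.
Implicit Types x y z e p q s n : V.

(** Here [P] is the projection onto the band generated by the positive part of
    [z] and [Q] the complementary one.  The negative part of [z] is disjoint
    from that band, which gives the signs of [P z] and [Q z]. *)
Lemma sign_projection z : uniformly_monotone V ->
  exists P Q : {linear V -> V},
    [/\ positive_operator P /\ positive_operator Q, forall x, P x + Q x = x,
      forall x y, 0 <=^b x -> 0 <=^b y -> P x `&`^b Q y <=^b 0,
      0 <=^b P z & Q z <=^b 0].
Proof.
move=> um; set e := bpos z; have e0 : 0 <=^b e by exact: bpos_ge0.
have /choice[f fP] : forall x, exists p, 0 <=^b x -> band_component e x p.
  move=> x; have [x0|nx0] := pselect (0 <=^b x); last by exists 0.
  by have [p xp] := band_component_exists um e0 x0; exists p.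
have fD x y : 0 <=^b x -> 0 <=^b y -> f (x + y) = f x + f y.
  move=> x0 y0; apply: (band_component_uniq (fP _ _)); first exact: ble_addr_ge0.
  by apply: band_componentD => //; exact: fP.
have fZ (r : R) x : 0 <= r -> 0 <=^b x -> f (r *: x) = r *: f x.
  move=> r0 x0; have [<-|rn0] := eqVneq 0 r.
    have /eqP := fD 0 0 (ble_refl 0) (ble_refl 0).
    by rewrite addr0 -subr_eq subrr eq_sym !scale0r => /eqP.
  apply: (band_component_uniq (fP _ _)); first exact: ble_scale.
  by apply: band_componentZ; [rewrite lt_neqAle rn0|exact: fP].
have [P Pf] := cone_linear_extension fD fZ.
have PP x : 0 <=^b x -> band_component e x (P x).
  by move=> x0; rewrite Pf//; exact: fP.
have P_ge0 x : 0 <=^b x -> 0 <=^b P x.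
  move=> x0; apply: ble_trans ((PP x x0).1 0 (lexx 0)).
  by rewrite scale0r; apply/ble_meetP; split=> //; exact: ble_refl.
have P_le x : 0 <=^b x -> P x <=^b x.
  by move=> x0; apply: (PP x x0).2 => r _; exact: ble_meetl.
have n0 : 0 <=^b bpos (- z) by exact: bpos_ge0.
have Pn : P (bpos (- z)) = 0.
  apply: ble_anti; last exact: P_ge0.
  apply: (PP _ n0).2 => r r0; apply: disjoint_scaler => //.
  by apply: ble_trans (bpos_disjoint z); apply/ble_meetP;
    split; [exact: ble_meetr|exact: ble_meetl].
have Pz : P z = P e by rewrite -{1}[z]bpos_sub linearB /= Pn subr0.
exists P, (idfun \- P); split.
- by split=> x x0; [exact: P_ge0|rewrite /= -ble_subr; exact: P_le].
- by move=> x; rewrite /= addrC subrK.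
- by move=> x y x0 y0; apply: (band_component_disjoint e0); exact: PP.
- by rewrite Pz; exact: P_ge0.
rewrite /= Pz ble_subl_addr add0r; apply: (ble_trans e); first exact: ble_joinr.
apply: ble_trans ((PP e e0).1 1 ler01); rewrite scale1r.
by apply/ble_meetP; split; exact: ble_refl.
Qed.

(** The element [p] stands for [|s - n|], and is [P (s - n) - Q (s - n)].  What
    [s + n] has in excess of it is twice the part of [n] in the positive band of
    [s - n] together with the part of [s] in the negative band. *)
Lemma sign_splitting s n : uniformly_monotone V ->
  exists P Q : {linear V -> V},
    [/\ positive_operator P /\ positive_operator Q, forall x, P x + Q x = x,
      forall x y, 0 <=^b x -> 0 <=^b y -> P x `&`^b Q y <=^b 0 &
      exists2 p, 0 <=^b p /\ `|s - n| <= `|p| &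
        p + ((P n + Q s) + (P n + Q s)) = s + n].
Proof.
move=> um; have [P [Q [PQ0 PQ disj Pz0 Qz0]]] := sign_projection (s - n) um.
have nQz0 : 0 <=^b - Q (s - n) by apply/ble_opp; rewrite opprK oppr0.
have nPz0 : - P (s - n) <=^b 0 by apply/ble_opp; rewrite opprK oppr0.
exists P, Q; split=> //; exists (P (s - n) - Q (s - n)).
  split; first exact: ble_addr_ge0.
  apply: ble_norm_dom.
    rewrite -{1}(PQ (s - n)); apply: ble_add; first exact: ble_refl.
    exact: ble_trans Qz0 nQz0.
  rewrite -{1}(PQ (s - n)) opprD; apply: ble_add; last exact: ble_refl.
  exact: ble_trans nPz0 Pz0.
rewrite [P (_ - _)]linearB [Q (_ - _)]linearB -[s in RHS]PQ -[n in RHS]PQ opprB.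
rewrite addrACA; congr (_ + _); first by rewrite addrA subrK.
by rewrite [P n + _]addrC addrA subrK addrC.
Qed.

End SignSplitting.

(** * Operator norms *)

Section Operators.
Local Set Implicit Arguments.
Local Unset Strict Implicit.
Context {R : realType} {X Y : banachLatticeType R}.

Lemma opnorm_le (F : X -> Y) (M : R) :
  (forall x, `|x| <= 1 -> `|F x| <= M) -> opnorm F <= M.
Proof.
move=> FM; apply: ge_sup => [|_ [x x1 <-]]; last exact: FM.
by exists `|F 0|, 0 => //=; rewrite normr0.
Qed.

Lemma unit_operator_le (S : {linear X -> Y}) x : unit_operator S ->
  `|x| <= 1 -> `|S x| <= 1.
Proof.
move=> [bS o1] x1; rewrite -o1; apply: ub_le_sup; last by exists x.
by have [M SM] := bS 1; exists M => _ [y y1 <-]; exact: SM.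
Qed.

Lemma unit_operatorI (T : {linear X -> Y}) u : `|u| <= 1 -> `|T u| = 1 ->
  (forall x, `|x| <= 1 -> `|T x| <= 1) -> unit_operator T.
Proof.
move=> u1 Tu T1; split.
  move=> r; exists (Num.max r 0) => x xr; have [->|xn0] := eqVneq x 0.
    by rewrite linear0 normr0 le_max lexx orbT.
  have nx : 0 < `|x| by rewrite normr_gt0.
  rewrite le_max; apply/orP; left; apply: le_trans xr.
  have := T1 (`|x|^-1 *: x); rewrite linearZ /= !normrZ normfV normr_id mulVf ?gt_eqF//.
  by move=> /(_ (lexx _)); rewrite ler_pdivrMl// mulr1.
apply/eqP; rewrite eq_le opnorm_le//=.
by rewrite -Tu; apply: ub_le_sup; [exists 1 => _ [y y1 <-]; exact: T1|exists u].
Qed.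

(** Dividing an operator that attains its norm and is close to a norm-one
    operator by that norm at most doubles the distance. *)
Lemma normalize_attaining (S T' : {linear X -> Y}) u (rho : R) :
  unit_operator S -> rho < 1 -> `|u| <= 1 ->
  (forall x, `|x| <= 1 -> `|T' x| <= `|T' u|) ->
  (forall x, `|x| <= 1 -> `|S x - T' x| <= rho) ->
  exists T : {linear X -> Y},
    [/\ `|u| = 1, unit_operator T, `|T u| = 1, opnorm (T \- S) <= rho + rho &
      exists2 k : R, 0 <= k & forall x, T x = k *: T' x].
Proof.
move=> uS rho1 u1 T'u ST; set c := `|T' u| in T'u *.
have c_le : c <= 1 + rho.
  rewrite /c -[T' u](subrK (S u)) addrC (le_trans (ler_normD _ _))// lerD//.
    exact: unit_operator_le.
  by rewrite distrC ST.
have le_c : 1 <= c + rho.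
  rewrite -uS.2; apply: opnorm_le => x x1.
  by rewrite -[S x](subrK (T' x)) addrC (le_trans (ler_normD _ _))// lerD ?ST ?T'u.
have c0 : 0 < c by lra.
have lin : linear (fun x => c^-1 *: T' x).
  by move=> r x y; rewrite linearP scalerDr !scalerA [_ * r]mulrC.
have [T TE] : exists T : {linear X -> Y}, forall x, T x = c^-1 *: T' x.
  pose T : {linear X -> Y} := HB.pack (fun x => c^-1 *: T' x)
    (GRing.isLinear.Build _ _ _ _ (fun x => c^-1 *: T' x) lin).
  by exists T.
have nT x : `|T x| = `|T' x| / c.
  by rewrite TE normrZ gtr0_norm ?invr_gt0// mulrC.
have T1 x : `|x| <= 1 -> `|T x| <= 1.
  by move=> x1; rewrite nT ler_pdivrMr// mul1r T'u.
have Tu : `|T u| = 1 by rewrite nT divff ?gt_eqF.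
exists T; split=> //; last by exists c^-1 => //; rewrite invr_ge0 ltW.
- apply/eqP; rewrite eq_le u1 /= leNgt; apply/negP => ult.
  have [u0|un0] := eqVneq u 0.
    by move: Tu; rewrite u0 linear0 normr0 => /eqP; rewrite eq_sym oner_eq0.
  have nu : 0 < `|u| by rewrite normr_gt0.
  have := T1 (`|u|^-1 *: u).
  rewrite linearZ /= !normrZ normfV normr_id mulVf ?gt_eqF// Tu mulr1 => /(_ (lexx _)).
  by rewrite leNgt invf_gt1// ult.
- exact: unit_operatorI Tu T1.
apply: opnorm_le => x x1 /=.
have -> : T x - S x = (T x - T' x) + (T' x - S x) by rewrite addrA subrK.
rewrite (le_trans (ler_normD _ _))// lerD//; last by rewrite distrC ST.
have -> : T x - T' x = (1 - c) *: T x.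
  by rewrite TE scalerBl scale1r !scalerA divff ?gt_eqF// scale1r.
rewrite normrZ (@le_trans _ _ (`|1 - c| * 1))//; first by rewrite ler_wpM2l// T1.
by rewrite mulr1 ler_norml; lra.
Qed.

End Operators.

(** * Real cutoff functions *)

Section Cutoff.
Local Set Implicit Arguments.
Local Unset Strict Implicit.
Context {R : realType}.
Implicit Types a t : R.

(** For [a > 0], piecewise linear from [0] at [1 - a] to [1] at [1 - a / 2]: the
    gap keeps [t] below [1 - a / 2] wherever [ramp a t] is not yet [1]. *)
Definition ramp a t : R := Num.max 0 (Num.min 1 ((t - (1 - a)) / (a / 2))).

(** Equal to [1] throughout the support of [ramp a], and to [-1] on its mirror
    image. *)
Definition flatten a t : R := Num.max (-1) (Num.min 1 (t / (1 - a))).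

(** Together with [flattenP] below, this reduces each inequality between the
    cutoffs to polynomial arithmetic in finitely many cases. *)
Lemma rampP a t : 0 < a ->
  [\/ ramp a t = 0 /\ t <= 1 - a,
      ramp a t = 1 /\ 1 - a / 2 <= t |
      (0 <= ramp a t <= 1) /\ 1 - a <= t <= 1 - a / 2].
Proof.
move=> a0; rewrite /ramp; set s := _ / _.
have sE : s * (a / 2) = t - (1 - a) by rewrite /s divfK// gt_eqF// divr_gt0.
have [s0|s0] := leP s 0.
  apply: Or31; rewrite min_r ?(le_trans s0)// max_l//; split=> //.
  have : s * (a / 2) <= 0 by rewrite mulr_le0_ge0// divr_ge0// ltW.
  by lra.
have [s1|s1] := leP 1 s.
  apply: Or32; rewrite max_r//; split=> //.
  have : 0 <= (s - 1) * (a / 2) by rewrite mulr_ge0 ?subr_ge0// divr_ge0// ltW.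
  by nra.
apply: Or33; rewrite (max_r (ltW s0)); split; first lra.
have : 0 <= s * (a / 2) by rewrite mulr_ge0 ?ltW// divr_gt0.
have : 0 <= (1 - s) * (a / 2) by rewrite mulr_ge0 ?subr_ge0 ?ltW// divr_gt0.
by nra.
Qed.

Lemma flattenP a t : 0 < a -> a <= 1 / 2 ->
  [\/ flatten a t = 1 /\ 1 - a <= t,
      flatten a t = -1 /\ t <= - (1 - a) |
      [/\ -1 <= flatten a t <= 1, flatten a t * (1 - a) = t & - (1 - a) <= t <= 1 - a]].
Proof.
move=> a0 a2; rewrite /flatten; set s := _ / _.
have b0 : 0 < 1 - a by lra.
have sE : s * (1 - a) = t by rewrite /s divfK// gt_eqF.
have [s1|s1] := leP 1 s.
  by apply: Or31; rewrite max_r; [split=> //; nra|lra].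
have [s0|s0] := leP s (-1); first by apply: Or32; split=> //; nra.
by apply: Or33; split=> //; [lra|apply/andP; split; nra].
Qed.

Lemma ramp_ge0 a t : 0 < a -> 0 <= ramp a t.
Proof. by move=> a0; have [[-> _]|[-> _]|[/andP[]]] := rampP t a0. Qed.

Lemma ramp_le a t : 0 < a -> a <= 1 / 2 -> ramp a t <= Num.max 0 t + Num.max 0 t.
Proof.
move=> a0 a2; have := rampP t a0; have [t0|t0] := leP t 0.
  by case=> [[-> _]|[-> h]|[/andP[_ h] /andP[h1 h2]]]; lra.
by case=> [[-> _]|[-> h]|[/andP[_ h] /andP[h1 h2]]]; lra.
Qed.

Lemma ramp_sum_le1 a t : 0 < a -> a <= 1 / 2 -> ramp a t + ramp a (- t) <= 1.
Proof.
move=> a0 a2; have := rampP t a0; have := rampP (- t) a0.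
by case=> [[-> ?]|[-> ?]|[/andP[? ?] /andP[? ?]]];
  case=> [[-> ?]|[-> ?]|[/andP[? ?] /andP[? ?]]]; lra.
Qed.

(** The last factor vanishes unless [|t| <= 1 - a / 2], and there is then room for
    [a / 2]. *)
Lemma ramp_room a t : 0 < a -> a <= 1 / 2 -> `|t| <= 1 ->
  `|t| + a / 2 * (1 - ramp a t - ramp a (- t)) <= 1.
Proof.
move=> a0 a2; rewrite ler_norml => /andP[t1 t2].
have := rampP t a0; have := rampP (- t) a0.
have [t0|/ltW t0] := leP t 0; [rewrite ler0_norm//|rewrite ger0_norm//];
  case=> [[-> ?]|[-> ?]|[/andP[? ?] /andP[? ?]]];
  case=> [[-> ?]|[-> ?]|[/andP[? ?] /andP[? ?]]]; nra.
Qed.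

Lemma flatten_ramp a t : 0 < a -> a <= 1 / 2 -> flatten a t * ramp a t = ramp a t.
Proof.
move=> a0 a2; have := rampP t a0; have := flattenP t a0 a2.
by case=> [[-> ?]|[-> ?]|[/andP[? ?] ? /andP[? ?]]];
  case=> [[-> ?]|[-> ?]|[/andP[? ?] /andP[? ?]]]; nra.
Qed.

Lemma flattenN a t : flatten a (- t) = - flatten a t.
Proof.
rewrite /flatten mulNr; set s := t / _.
have [s1|s1] := leP 1 s; have [s0|s0] := leP s (-1).
all: rewrite /Num.max /Num.min.
all: do 4 ?case: ifP; lra.
Qed.

Lemma flatten_norm a t : 0 < a -> a <= 1 / 2 -> `|flatten a t| <= 1.
Proof.
move=> a0 a2; rewrite ler_norml; have := flattenP t a0 a2.
by case=> [[-> ?]|[-> ?]|[/andP[? ?] ? /andP[? ?]]]; lra.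
Qed.

Lemma flatten_near a t : 0 < a -> a <= 1 / 2 -> `|t| <= 1 -> `|flatten a t - t| <= a.
Proof.
move=> a0 a2; rewrite !ler_norml; have := flattenP t a0 a2.
by case=> [[-> ?]|[-> ?]|[/andP[? ?] ? /andP[? ?]]] /andP[? ?]; apply/andP; split; nra.
Qed.

Lemma flatten_le a t : 0 < a -> a <= 1 / 2 -> `|flatten a t| <= 2 * `|t|.
Proof.
move=> a0 a2; case: (flattenP t a0 a2) => [[-> ?]|[-> ?]|[_ ft _]].
- by rewrite normr1 ger0_norm; lra.
- by rewrite normrN normr1 ler0_norm; lra.
have := normr_ge0 (flatten a t); rewrite -[in X in _ -> _ <= X]ft normrM.
by rewrite (@ger0_norm _ (1 - a)); [nra|lra].
Qed.

Lemma ramp_continuous (a : R) : continuous (ramp a).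
Proof.
move=> t; pose l (s : R) : R := (s - (1 - a)) / (a / 2).
apply: (@continuous_max R R (cst 0) (cst 1 \min l)); first exact: cvg_cst.
apply: (@continuous_min R R (cst 1) l); first exact: cvg_cst.
by apply: cvgM; last exact: cvg_cst; apply: cvgB; [exact: cvg_id|exact: cvg_cst].
Qed.

Lemma flatten_continuous (a : R) : continuous (flatten a).
Proof.
move=> t; pose l (s : R) : R := s / (1 - a).
apply: (@continuous_max R R (cst (-1)) (cst 1 \min l)); first exact: cvg_cst.
apply: (@continuous_min R R (cst 1) l); first exact: cvg_cst.
by apply: cvgM; [exact: cvg_id|exact: cvg_cst].
Qed.

Lemma ramp_norm_le (a t : R) : 0 < a -> a <= 1 / 2 -> `|ramp a t| <= 2 * `|t|.
Proof.
move=> a0 a2; rewrite ger0_norm ?ramp_ge0//; have := ramp_le t a0 a2.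
have : Num.max 0 t <= `|t| by rewrite ge_max normr_ge0 ler_norm.
by lra.
Qed.

End Cutoff.

(** * Composition and products in [C0 R L] *)

Section C0Theory.
Local Set Implicit Arguments.
Local Unset Strict Implicit.
Context {R : realType} {L : topologicalType}.
Implicit Types f g : C0 R L.

Lemma C0_comp_subproof (g : R -> R) (K : R) f : continuous g ->
  (forall t, `|g t| <= K * `|t|) -> g \o f \in @C0_pred R L.
Proof.
move=> cg gK; apply/C0_predP; split.
  by move=> x; apply: continuous_comp; [exact: C0_continuous|exact: cg].
apply: (vanishes_dom (@C0_vanishes _ _ (K *: f)) (@C0_vanishes _ _ 0)) => x.
rewrite C0_0 normr0 addr0 C0Z normrM /=.
by rewrite (le_trans (gK _))// ler_wpM2r// ler_norm.
Qed.

Definition C0_comp (g : R -> R) (K : R) f (cg : continuous g)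
  (gK : forall t, `|g t| <= K * `|t|) : C0 R L := MkC0 (C0_comp_subproof f cg gK).

Lemma C0_mul_subproof f g : (f : L -> R) \* g \in @C0_pred R L.
Proof.
have [M gM] := C0_bounded g.
apply/C0_predP; split; first by move=> x; apply: cvgM; exact: C0_continuous.
apply: (vanishes_dom (@C0_vanishes _ _ (M *: f)) (@C0_vanishes _ _ 0)) => x.
rewrite C0_0 normr0 addr0 C0Z !normrM mulrC ler_wpM2r//.
by rewrite (le_trans (gM x))// ler_norm.
Qed.

Definition C0_mul f g : C0 R L := MkC0 (C0_mul_subproof f g).

Lemma C0_mulE f g x : C0_mul f g x = f x * g x. Proof. by []. Qed.

Lemma C0_bposE f x : bpos f x = Num.max 0 (f x). Proof. by []. Qed.

Lemma C0_bleP f g : f <=^b g <-> forall x, f x <= g x. Proof. by []. Qed.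

Lemma C0_norm_leP f (M : R) : 0 <= M -> (`|f| <= M <-> forall x, `|f x| <= M).
Proof.
move=> M0; split=> [fM x|]; last exact: C0_norm_le.
by rewrite (le_trans (C0_norm_ub f x)).
Qed.

End C0Theory.

(** * The approximating operator *)

Lemma spliced_operator (R : realType) (L : topologicalType)
    (Y : banachLatticeType R) (S : {linear C0 R L -> Y}) (P Q : {linear Y -> Y})
    (phi psi : C0 R L) :
  exists T : {linear C0 R L -> Y},
    forall f, T f = P (S (C0_mul f phi)) + Q (S (C0_mul f psi)).
Proof.
pose T0 (f : C0 R L) := P (S (C0_mul f phi)) + Q (S (C0_mul f psi)).
have mulP (k : R) (f g h : C0 R L) :
    C0_mul (k *: f + g) h = k *: C0_mul f h + C0_mul g h.
  by apply: C0P => t; rewrite C0D C0Z !C0_mulE C0D C0Z mulrDl mulrA.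
have T0lin : linear T0.
  move=> k f g; have Slin u v : S (k *: u + v) = k *: S u + S v by exact: linearP.
  have Plin u v : P (k *: u + v) = k *: P u + P v by exact: linearP.
  have Qlin u v : Q (k *: u + v) = k *: Q u + Q v by exact: linearP.
  by rewrite /T0 !mulP !Slin Plin Qlin scalerDr addrACA.
pose T : {linear C0 R L -> Y} :=
  HB.pack T0 (GRing.isLinear.Build _ _ _ _ T0 T0lin).
by exists T => f; reflexivity.
Qed.

(** With [a = eps / 2], evaluating the modulus at [eps ^+ 2 / 32] bounds the two
    errors in [S - T'] by [eps / 8] and [eps ^+ 2 / 32], which add up to at most
    [eps / 4]; normalization doubles this. *)
Lemma bpb_positive_at_C0 (R : realType) (L : topologicalType)
    (Y : banachLatticeType R) (eps delta : R) :
  uniformly_monotone Y -> 0 < eps < 1 -> 0 < delta <= 1 ->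
  uniformly_monotone_at Y (eps ^+ 2 / 32) delta ->
  bpb_positive_at (C0 R L) Y eps (delta / 2).
Proof.
move=> umY /andP[e0 e1] d01 umd S uS S0 x0 nx0 Sx0.
set r := eps ^+ 2 / 32 in umd *; pose a := eps / 2.
have a0 : 0 < a by rewrite divr_gt0.
have a2 : a <= 1 / 2 by rewrite /a; lra.
have r_gt0 : 0 < r by rewrite divr_gt0 ?exprn_gt0.
have Smono := positive_operator_mono S0.
have um (p q : Y) :=
  @uniformly_monotone_small _ _ r delta p q umd (ltW r_gt0) d01.
have x0_le1 t : `|x0 t| <= 1 by rewrite -nx0; exact: C0_norm_ub.
have cN : continuous (fun t : R => ramp a (- t)).
  move=> t; apply: (@continuous_comp _ _ _ (fun t : R => - t) (ramp a)).
    by apply: cvgN; exact: cvg_id.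
  exact: ramp_continuous.
have bN t : `|ramp a (- t)| <= 2 * `|t| by rewrite -(normrN t); exact: ramp_norm_le.
have bnorm (t : R) : `| `|t| | <= 1 * `|t| by rewrite mul1r normr_id.
pose phi := C0_comp x0 (@ramp_continuous R a) (fun t => ramp_norm_le t a0 a2).
pose psi := C0_comp x0 cN bN.
pose u0 := C0_comp x0 (@flatten_continuous R a) (fun t => flatten_le t a0 a2).
pose modulus (f : C0 R L) := C0_comp f (@norm_continuous R R) bnorm.
have phiE t : phi t = ramp a (x0 t) by [].
have psiE t : psi t = ramp a (- x0 t) by [].
have u0E t : u0 t = flatten a (x0 t) by [].
have modE f t : modulus f t = `|f t| by [].
have phi0 t : 0 <= phi t by exact: ramp_ge0.
have psi0 t : 0 <= psi t by exact: ramp_ge0.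
pose xp := bpos x0; pose xn := bpos (- x0).
have xp0 : 0 <=^b xp by exact: bpos_ge0.
have xn0 : 0 <=^b xn by exact: bpos_ge0.
have zE : S x0 = S xp - S xn by rewrite -{1}[x0]bpos_sub linearB.
have [P [Q [[P0 Q0] PQ disj [p [p0 zp] pE]]]] := sign_splitting (S xp) (S xn) umY.
rewrite -zE in zp.
pose w := P (S xn) + Q (S xp).
have Pmono := positive_operator_mono P0; have Qmono := positive_operator_mono Q0.
have w0 : 0 <=^b w by apply: ble_addr_ge0; [apply: P0|apply: Q0]; exact: S0.
have absxE t : xp t + xn t = `|x0 t|.
  by rewrite !C0_bposE C0N; have [h|h] := leP 0 (x0 t);
    [rewrite ger0_norm// max_l|rewrite ltr0_norm// max_r]; lra.
(* [S |x0|] has norm at most [1] and exceeds [|S x0|] by [w + w] *)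
have Sabs1 : `|S (xp + xn)| <= 1.
  apply: (unit_operator_le uS); apply/C0_norm_leP => // t.
  by rewrite C0D absxE normr_id.
have w_small : `|w + w| <= r.
  apply: (um p) => //; first exact: ble_addr_ge0.
    exact: lt_le_trans zp.
  by rewrite pE -linearD.
(* [S |x0|] is nearly of full norm, which leaves little room for [(a / 2) S g] *)
have Sg_small (g : C0 R L) : 0 <=^b g ->
    (forall t, xp t + xn t + a / 2 * g t <= 1) -> `|S g| <= eps / 8.
  move=> g0 g1.
  have : `|(a / 2) *: S g| <= r.
    apply: (um (S (xp + xn))).
    - by apply: S0; exact: ble_addr_ge0.
    - by apply: ble_scale; [rewrite divr_ge0 ?ltW|exact: S0].
    - rewrite (lt_le_trans Sx0)//; apply: ble_norm_dom.
        by apply: Smono => t; rewrite C0D absxE ler_norm.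
      rewrite -linearN; apply: Smono => t.
      by rewrite C0D absxE C0N -normrN ler_norm.
    - rewrite -linearZ -linearD; apply: (unit_operator_le uS).
      apply/C0_norm_leP => // t.
      rewrite !C0D absxE C0Z ger0_norm; first by rewrite -absxE; exact: g1.
      apply: addr_ge0 => //; apply: mulr_ge0; last exact: g0.
      by rewrite divr_ge0 ?(ltW a0).
  rewrite normrZ ger0_norm ?divr_ge0 ?(ltW a0) ?(ltW e0)// /a /r => h.
  by rewrite -(ler_pM2l e0); lra.
have rest1 t : xp t + xn t + a / 2 * (1 - phi t - psi t) <= 1.
  by rewrite absxE phiE psiE; exact: ramp_room.
have [T' T'E] := spliced_operator _ _ _ S P Q phi psi.
pose A := P (S phi); pose B := Q (S psi).
(* [T'] maps the unit ball into the order interval bounded by [A + B] *)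
have T'le (f : C0 R L) : (forall t, f t <= 1) -> T' f <=^b A + B.
  move=> f1; rewrite T'E; apply: ble_add; [apply: Pmono|apply: Qmono];
    apply: Smono => t; rewrite C0_mulE.
    by rewrite ler_piMl.
  by rewrite ler_piMl.
have u0_1 : `|u0| <= 1 by apply/C0_norm_leP => // t; exact: flatten_norm.
have T'u0 : T' u0 = A - B.
  rewrite T'E; have -> : C0_mul u0 phi = phi.
    by apply: C0P => t; rewrite C0_mulE; exact: flatten_ramp.
  have -> : C0_mul u0 psi = - psi.
    apply: C0P => t; rewrite C0_mulE C0N u0E psiE -{1}[x0 t]opprK.
    by rewrite flattenN mulNr flatten_ramp.
  by rewrite [S (- _)]linearN [Q (- _)]linearN.
have attains (f : C0 R L) : `|f| <= 1 -> `|T' f| <= `|T' u0|.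
  move=> /(C0_norm_leP _ ler01).1 f1; apply: (@le_trans _ _ `|A + B|).
    apply: ble_norm_dom; first by apply: T'le => t; rewrite (le_trans (ler_norm _)).
    by rewrite -linearN; apply: T'le => t; rewrite C0N (le_trans (ler_norm _))// normrN.
  rewrite T'u0; apply: disjoint_norm_le; [apply: P0|apply: Q0|apply: disj]; exact: S0.
have phi_xp : phi <=^b xp + xp by move=> t; exact: ramp_le.
have psi_xn : psi <=^b xn + xn by move=> t; exact: ramp_le.
(* [S - T'] consists of [S] off the supports of the cutoffs and of the cross
   terms between the bands, which the excess [w + w] dominates *)
have ST'_le (f m : C0 R L) : (forall t, f t <= m t <= 1) ->
    S f - T' f <=^b S (m - C0_mul m phi - C0_mul m psi) + (w + w).
  move=> fm.
  have f1 t : f t <= 1 by have /andP[? ?] := fm t; exact: (@le_trans _ _ (m t)).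
  have -> : S f - T' f = S (f - C0_mul f phi - C0_mul f psi) +
      (P (S (C0_mul f psi)) + Q (S (C0_mul f phi))).
    rewrite T'E ![S (_ - _)]linearB.
    move: (S f) (S (C0_mul f phi)) (S (C0_mul f psi)) => s u v.
    have uvE : P v + Q u + (P u + Q v) = u + v.
      by rewrite [P v + _]addrC addrACA [Q u + _]addrC !PQ.
    apply/eqP; rewrite subr_eq -[X in _ == X]addrA uvE.
    by rewrite -[s - u - v]addrA -opprD subrK.
  apply: ble_add.
    apply: Smono => t; rewrite !(C0D, C0N) !C0_mulE phiE psiE.
    have := ramp_sum_le1 (x0 t) a0 a2; have /andP[h _] := fm t.
    by nra.
  rewrite /w addrACA -!linearD; apply: ble_add.
    apply: Pmono; apply: Smono; apply: ble_trans psi_xn => t.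
    by rewrite C0_mulE ler_piMl.
  apply: Qmono; apply: Smono; apply: ble_trans phi_xp => t.
  by rewrite C0_mulE ler_piMl.
have ST' (f : C0 R L) : `|f| <= 1 -> `|S f - T' f| <= eps / 4.
  move=> /(C0_norm_leP _ ler01).1 f1.
  set g := modulus f - C0_mul (modulus f) phi - C0_mul (modulus f) psi.
  have gE t : g t = `|f t| * (1 - phi t - psi t).
    by rewrite /g !(C0D, C0N) !C0_mulE modE; ring.
  apply: (@le_trans _ _ `|S g + (w + w)|).
    apply: ble_norm_dom.
      by apply: ST'_le => t; rewrite modE ?f1 ?ler_norm ?andbT.
    have -> : - (S f - T' f) = S (- f) - T' (- f).
      by rewrite ![_ (- f)]linearN opprB opprK addrC.
    apply: ST'_le => t.
    by rewrite modE f1 C0N -normrN ler_norm.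
  rewrite (le_trans (ler_normD _ _))// (@le_trans _ _ (eps / 8 + r))//.
    have rest0 t : 0 <= 1 - phi t - psi t.
      by have := ramp_sum_le1 (x0 t) a0 a2; rewrite phiE psiE; lra.
    rewrite lerD// Sg_small// => [|t].
      by apply/C0_bleP => t; rewrite C0_0 gE mulr_ge0.
    apply: le_trans (rest1 t); rewrite lerD2l; apply: ler_wpM2l.
      by rewrite divr_ge0 ?(ltW a0).
    by rewrite gE ler_piMl.
  by rewrite /r; nra.
have eps4 : eps / 4 < 1 by lra.
have [T [u0n uT Tu0 TS [k k0 TE]]] :=
  normalize_attaining uS eps4 u0_1 attains ST'.
exists u0, T; split; split=> //.
- move=> f f0; rewrite TE; apply: ble_scale => //; rewrite T'E.
  by apply: ble_addr_ge0; [apply: P0|apply: Q0]; apply: S0 => t;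
    rewrite C0_mulE mulr_ge0//; exact: f0.
- rewrite (@le_lt_trans _ _ a)// /a ?ltr_pdivrMr ?ltr_pMr ?ltr1n//.
  apply/C0_norm_leP => [|t]; first exact: ltW.
  exact: flatten_near.
rewrite (le_lt_trans TS)//; lra.
Qed.

Theorem corollary2p11 (R : realType) :
  (forall (L : topologicalType) (Y : banachLatticeType R),
     hausdorff_space L -> locally_compact [set: L] ->
     uniformly_monotone Y -> (exists e : Y, weak_unit e) ->
     bpb_positive (C0 R L) Y) /\
  (forall delta : R -> R,
     (forall eps : R, 0 < eps < 1 -> 0 < delta eps <= eps) ->
     exists2 eta : R -> R, (forall eps : R, 0 < eps < 1 -> 0 < eta eps < eps) &
       forall (L : topologicalType) (Y : banachLatticeType R),
         hausdorff_space L -> locally_compact [set: L] ->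
         uniformly_monotone Y -> (exists e : Y, weak_unit e) ->
         monotonicity_modulus Y delta ->
         forall eps : R, 0 < eps < 1 ->
           bpb_positive_at (C0 R L) Y eps (eta eps)).
Proof.
have scale (eps : R) : 0 < eps < 1 -> 0 < eps ^+ 2 / 32 < 1.
  by move=> /andP[e0 e1]; apply/andP; split; [rewrite divr_gt0 ?exprn_gt0|nra].
have half (eps d : R) : 0 < eps < 1 -> 0 < d <= eps ^+ 2 / 32 ->
    0 < d / 2 < eps /\ 0 < d <= 1.
  move=> /andP[e0 e1] /andP[d0 d1].
  by split; apply/andP; split; [lra|nra|lra|nra].
split=> [L Y _ _ umY _ eps eps01|delta delta01].
  have [d d0 umd] := umY _ (scale _ eps01).
  have [h1 h2] := half _ _ eps01 d0.
  by exists (d / 2) => //; exact: bpb_positive_at_C0.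
exists (fun eps => delta (eps ^+ 2 / 32) / 2) => [eps eps01|].
  exact: (half _ _ eps01 (delta01 _ (scale _ eps01))).1.
move=> L Y _ _ umY _ mod_delta eps eps01.
have [d0 umd] := mod_delta _ (scale _ eps01).
by apply: bpb_positive_at_C0 => //; exact: (half _ _ eps01 d0).2.
Qed.
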